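(* Let $E$ be a set and, for $i\in\{0,1\}$, let $M_i$ be a matroid on $E$ which is the direct sum of a finitary and a cofinitary matroid, and let $F_i\subseteq E$. Then there exists an $F\subseteq E$ such that $\mathsf{span}_{M_i}(F)\supseteq F_i$ and $\mathsf{span}_{M_i^{*}}(E\setminus F)\supseteq E\setminus F_{1-i}$ for $i\in\{0,1\}$.
   Context: Matroids may be infinite: a matroid $M=(E,\mathcal{I}_M)$ on a (possibly infinite) set $E$ is a family $\mathcal{I}_M\subseteq\mathcal{P}(E)$ of ''independent'' sets such that (I) $\varnothing\in\mathcal{I}_M$; (II) $\mathcal{I}_M$ is downward closed; (III) for all $I,J\in\mathcal{I}_M$ with $J$ $\subseteq$-maximal in $\mathcal{I}_M$ and $I$ not, there is $e\in J\setminus I$ with $I+e\in\mathcal{I}_M$; (IV) for every $X\subseteq E$, every $I\in\mathcal{I}_M\cap\mathcal{P}(X)$ extends to a $\subseteq$-maximal element of $\mathcal{I}_M\cap\mathcal{P}(X)$. Bases are maximal independent sets, circuits are minimal dependent sets. The dual $M^*$ is the matroid on $E$ whose bases are the complements of the bases of $M$. $M$ is finitary if all its circuits are finite and cofinitary if $M^*$ is finitary. ''Direct sum of a finitary and a cofinitary matroid'' means $E=E'\sqcup E''$ with $M$ the direct sum of a finitary matroid on $E'$ and a cofinitary matroid on $E''$ (equivalently every component of $M$ is finitary or cofinitary). For $X\subseteq E$, $\mathsf{span}_M(X)$ is the set of $e\in E$ such that $e\in X$ or there is a circuit $C\ni e$ of $M$ with $C-e\subseteq X$. *)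

(* Defs.v *)
From mathcomp Require Import all_boot all_classical.

Set Implicit Arguments.
Unset Strict Implicit.
Unset Printing Implicit Defensive.

Local Open Scope classical_set_scope.

Definition max_set (T : Type) (P : set (set T)) (A : set T) : Prop :=
  P A /\ forall B, P B -> A `<=` B -> B = A.

Definition min_set (T : Type) (P : set (set T)) (A : set T) : Prop :=
  P A /\ forall B, P B -> B `<=` A -> B = A.

(* Possibly infinite matroids on the ground set E. The ground set is a subset
   of a type rather than a type, so that the summands of a direct sum are
   matroids over the same type. *)
Record matroid (T : Type) (E : set T) := Matroid {
  indep : set (set T);
  indep_ground : forall I, indep I -> I `<=` E;
  indep0 : indep set0;
  indepS : forall I J, indep J -> I `<=` J -> indep I;
  indep_exchange : forall I J, indep I -> ~ max_set indep I ->
    max_set indep J -> exists2 e, (J `\` I) e & indep (e |` I);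
  indep_max : forall X I, X `<=` E -> indep I -> I `<=` X ->
    exists2 J, max_set [set K | indep K /\ K `<=` X] J & I `<=` J }.

Section Matroid.
Context {T : Type} {E : set T}.
Implicit Types (M : matroid E) (I J B C X : set T).

Definition basis M : set (set T) := max_set (indep M).

Definition dependent M : set (set T) := [set X | X `<=` E /\ ~ indep M X].

Definition circuit M : set (set T) := min_set (dependent M).

Definition span M X : set T :=
  [set e | E e /\ (X e \/ exists C, [/\ circuit M C, C e & C `\ e `<=` X])].

Definition dual_indep M : set (set T) :=
  [set I | exists2 B, basis M B & I `<=` E `\` B].

Lemma basis_ground M B : basis M B -> B `<=` E.
Proof. by case=> /indep_ground. Qed.

Lemma basis_ext M I : indep M I -> exists2 B, basis M B & I `<=` B.
Proof.
move=> iI; have [|B [[iB BE] Bmax] IB] := indep_max (X := E) _ iI (indep_ground iI).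
  by [].
by exists B => //; split=> // K iK; apply: Bmax; split=> //; exact: indep_ground iK.
Qed.

Lemma basis_ext_in M I B : indep M I -> basis M B ->
  exists B', [/\ basis M B', I `<=` B' & B' `<=` I `|` B].
Proof.
move=> iI bB.
have IBE : I `|` B `<=` E.
  by move=> x [/(indep_ground iI)|/(basis_ground bB)].
have [J [[iJ JIB] Jmax] IJ] := indep_max IBE iI (@subsetUl _ I B).
exists J; split=> //; apply: contrapT => nJ.
have [e [Be nJe] iJe] := indep_exchange iJ nJ bB.
apply: nJe; rewrite -(Jmax (e |` J)); first by left.
  by split=> // x [->|/JIB//]; right.
by move=> x; right.
Qed.

Lemma basis_dual_indep M A :
  max_set (dual_indep M) A <-> exists2 B, basis M B & A = E `\` B.
Proof.
split=> [[[B bB AB] Amax]|[B bB ->]].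
  by exists B => //; rewrite (Amax (E `\` B)) //; exists B.
split; first by exists B.
move=> K [B' bB' KB'] BK.
have B'B : B' `<=` B.
  move=> x B'x; apply: contrapT => nBx.
  by have [_] := KB' _ (BK x (conj (basis_ground bB' B'x) nBx)).
have eB : B = B' by apply: bB'.2 => //; exact: bB.1.
by apply/seteqP; split=> //; rewrite eB.
Qed.

Lemma dual_ground M I : dual_indep M I -> I `<=` E.
Proof. by case=> B _ IB x /IB []. Qed.

Lemma dual0 M : dual_indep M set0.
Proof. by have [B bB _] := basis_ext (indep0 M); exists B. Qed.

Lemma dualS M I J : dual_indep M J -> I `<=` J -> dual_indep M I.
Proof. by case=> B bB JB IJ; exists B => // x /IJ/JB. Qed.

Lemma dual_exchange M I J : dual_indep M I -> ~ max_set (dual_indep M) I ->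
  max_set (dual_indep M) J -> exists2 e, (J `\` I) e & dual_indep M (e |` I).
Proof.
move=> [B' bB' IB'] nI /basis_dual_indep [B bB ->].
have iBI : indep M (B `\` I) by apply: (indepS bB.1) => x [].
have [B2 [bB2 sB2 B2s]] := basis_ext_in iBI bB'.
have B2I x : B2 x -> ~ I x.
  by move=> /B2s [[]//|B'x] /IB' [].
apply: contrapT => nex; apply: nI; apply/basis_dual_indep; exists B2 => //.
apply/seteqP; split=> [x Ix|x [Ex nB2x]].
  by split; [have [] := IB' _ Ix | move=> /B2I].
apply: contrapT => nIx; apply: nex; exists x.
  by split=> //; split=> // Bx; apply/nB2x/sB2.
exists B2 => // y [->//|Iy].
by split; [have [] := IB' _ Iy | move=> /B2I].
Qed.

Lemma dual_max M X I : X `<=` E -> dual_indep M I -> I `<=` X ->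
  exists2 J, max_set [set K | dual_indep M K /\ K `<=` X] J & I `<=` J.
Proof.
move=> XE [B bB IB] IX.
have [|J [[iJ JX] Jmax] _] :=
  indep_max (X := E `\` X) _ (indep0 M) (@sub0set _ _); first by move=> x [].
have [B2 [bB2 JB2 B2s]] := basis_ext_in iJ bB.
exists (X `\` B2); last first.
  move=> x Ix; split; first exact: IX.
  by move=> /B2s [/JX []|]; [move=> _; apply; exact: IX | have [] := IB _ Ix].
split; first by split=> [|x []//]; exists B2 => // x [/XE].
move=> K [[B3 bB3 KB3] KX] sK.
apply/seteqP; split=> // k Kk; split; first exact: KX.
move=> B2k; have [Ek nB3k] := KB3 _ Kk.
have iBk : indep M (B2 `\ k) by apply: (indepS bB2.1) => x [].
have nBk : ~ max_set (indep M) (B2 `\ k).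
  move=> [_ /(_ B2 bB2.1 (@subDsetl _ _ _)) eB].
  by move: B2k; rewrite eB => -[_ /(_ erefl)].
have [e [B3e nB2e] iBe] := indep_exchange iBk nBk bB3.
have nke : e <> k by move=> ek; apply: nB3k; rewrite -ek.
have {}nB2e : ~ B2 e by move=> B2e; apply: nB2e; split.
have nXe : ~ X e.
  by move=> Xe; have [_] := KB3 _ (sK _ (conj Xe nB2e)); apply.
have nJk : ~ J k by move=> /JX [_]; apply; exact: KX.
apply/nB2e/JB2; rewrite -(Jmax (e |` J)); first by left.
  split; last by move=> x [->|/JX//]; split=> //; exact: basis_ground bB3 _ B3e.
  apply: (indepS iBe) => x [->|Jx]; first by left.
  by right; split; [exact: JB2 | move=> xk; apply: nJk; rewrite -xk].
by move=> x; right.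
Qed.

Definition dual M : matroid E :=
  Matroid (@dual_ground M) (@dual0 M) (@dualS M) (@dual_exchange M)
    (@dual_max M).

Lemma basis_dual M A : basis (dual M) A <-> exists2 B, basis M B & A = E `\` B.
Proof. exact: basis_dual_indep. Qed.

Definition finitary M : Prop := forall C, circuit M C -> finite_set C.

Definition cofinitary M : Prop := finitary (dual M).

End Matroid.

Definition is_direct_sum (T : Type) (E E1 E2 : set T)
    (M : matroid E) (M1 : matroid E1) (M2 : matroid E2) : Prop :=
  [/\ E = E1 `|` E2, E1 `&` E2 = set0 &
      forall I, indep M I <->
        exists I1 I2, [/\ indep M1 I1, indep M2 I2 & I = I1 `|` I2]].

Definition finitary_cofinitary_sum (T : Type) (E : set T) (M : matroid E) :
    Prop :=
  exists (E1 E2 : set T) (M1 : matroid E1) (M2 : matroid E2),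
    [/\ is_direct_sum M M1 M2, finitary M1 & cofinitary M2].

(* Main.v *)
(* Fleiner's matroid kernels. For i in {0, 1} let C_i select from a set X all
   of X `&` F_(1-i) and, greedily along an order of E, a base of the rest of X
   over it. The order is a well-order on the finitary summand and a reversed
   well-order on the cofinitary one: greedy selection spans in the first case
   because descents terminate and is independent because finite circuits have a
   last element; the second case is dual. Since R_i X = X `\` C_i X is monotone,
   Knaster-Tarski yields X_0, X_1 with X_1 = E `\` R_0 X_0 and
   X_0 = E `\` R_1 X_1, and F = X_0 `&` X_1 = C_0 X_0 = C_1 X_1 works: an element
   of F_i is never rejected by C_(1-i), so it lies in X_i, which C_i X_i spans,
   and the elements of F outside F_(1-i) are coloops of F in M_i. *)
Require Import Defs.
From mathcomp Require Import all_boot all_classical.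
From mathcomp Require wochoice.
Local Open Scope classical_set_scope.

Set Implicit Arguments.
Unset Strict Implicit.
Unset Printing Implicit Defensive.

(** * Circuits, span and orthogonality of circuits and cocircuits *)

Section Span.
Context {T : Type} {E : set T}.
Implicit Types (M : matroid E) (I B C D X Y Z : set T).

Lemma circuit_ground M C : circuit M C -> C `<=` E.
Proof. by case=> -[]. Qed.

Lemma circuit_dep M C : circuit M C -> ~ indep M C.
Proof. by case=> -[]. Qed.

Lemma circuit_properN M C X x : circuit M C -> X `<=` C -> C x -> ~ X x ->
  indep M X.
Proof.
move=> [[CE _] Cmin] XC Cx nXx; apply: contrapT => dX.
by apply: nXx; rewrite (Cmin X) //; split=> // y /XC/CE.
Qed.

Lemma circuit_setD1 M C x : circuit M C -> C x -> indep M (C `\ x).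
Proof.
by move=> cC Cx; apply: (circuit_properN cC _ Cx) => [y []//|[_]]; apply.
Qed.

(** Dependent sets need not contain a circuit by any finiteness argument, so the circuit is written
    down explicitly from a basis extending [I]. *)
Lemma fundamental_circuit M I e : indep M I -> E e -> ~ indep M (e |` I) ->
  exists C, [/\ circuit M C, C e & C `<=` e |` I].
Proof.
move=> iI Ee dI; have [B bB IB] := basis_ext iI.
have iB : indep M B by case: bB.
have nBe : ~ B e.
  by move=> Be; apply: dI; apply: (indepS iB) => x [->|/IB].
pose C := [set x | (e |` B) x /\ indep M ((e |` B) `\ x)].
have Ce : C e.
  split; first by left.
  by apply: (indepS iB) => x [[->|//]]; case.
have CE : C `<=` E.
  by move=> x [[->//|/(basis_ground bB)]].
exists C; split=> //; last first.
  move=> x [[->|Bx] ix]; first by left.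
  right; apply: contrapT => nIx; apply: dI; apply: (indepS ix) => y [->|Iy].
    by split; [left | move=> ex; apply: nBe; rewrite ex].
  by split; [right; exact: IB | move=> yx; apply: nIx; rewrite -yx].
split; first split=> //.
  (* If [C] were independent, a basis [B'] containing it would omit some [y] of [B]. Exchange from
     [B]\ y[towards]B'[can only add]e[, so deleting]y[from]e |[B] leaves an independent set. This
     puts [y] into [C], hence into [B']. *)
  move=> iC; have [B' [bB' CB' B's]] := basis_ext_in iC bB.
  have iB' : indep M B' by case: bB'.
  have [y By nB'y] : exists2 y, B y & ~ B' y.
    apply: contrapT => nex; apply: nBe; suff <- : B' = B by exact: CB'.
    apply: bB.2 => // y By; apply: contrapT => nB'y.
    by apply: nex; exists y.
  have iBy : indep M (B `\ y) by apply: (indepS iB) => x [].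
  have nBy : ~ max_set (indep M) (B `\ y).
    move=> [_ /(_ B iB (@subDsetl _ _ _)) eB].
    by move: By; rewrite eB => -[_]; apply.
  have [z [B'z nBz] iz] := indep_exchange iBy nBy bB'.
  have ez : z = e.
    have zy : z <> y by move=> zy; apply: nB'y; rewrite -zy.
    by case: (B's _ B'z) => [[[//|Bz] _]|Bz]; case: nBz.
  apply/nB'y/CB'; split; first by right.
  apply: (indepS iz) => x [[->|Bx] xy]; first by left; rewrite ez.
  by right.
move=> X [_ dX] XC; apply/seteqP; split=> // x Cx.
apply: contrapT => nXx; apply: dX; apply: (indepS Cx.2) => y Xy.
split; first by have [] := XC _ Xy.
by move=> yx; apply: nXx; rewrite -yx.
Qed.

Lemma spanS M X Y : X `<=` Y -> span M X `<=` span M Y.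
Proof.
move=> XY e [Ee [Xe|[C [cC Ce CX]]]]; split=> //; first by left; exact: XY.
by right; exists C; split=> // x /CX/XY.
Qed.

Lemma sub_span M X : X `<=` E -> X `<=` span M X.
Proof. by move=> XE e Xe; split; [exact: XE | left]. Qed.

Lemma span_indep M I e : indep M I -> E e -> ~ indep M (e |` I) -> span M I e.
Proof.
move=> iI Ee /(fundamental_circuit iI Ee) [C [cC Ce CI]]; split=> //; right.
by exists C; split=> // x [/CI [->|//]]; case.
Qed.

Lemma max_indep_ex M X : exists I, max_set [set K | indep M K /\ K `<=` X] I.
Proof.
have XE : X `&` E `<=` E by move=> x [].
have [J [[iJ JX] Jmax] _] := indep_max XE (indep0 M) (@sub0set _ _).
exists J; split=> [|K [iK KX] JK].
  by split=> // x /JX [].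
apply: Jmax => //; split=> // x Kx.
by split; [exact: KX | exact: indep_ground iK _ Kx].
Qed.

Lemma max_indep_span M X I e :
  max_set [set K | indep M K /\ K `<=` X] I -> span M X e ->
  I e \/ ~ indep M (e |` I).
Proof.
move=> [[iI IX] Imax] [Ee Xe].
have add x : X x -> indep M (x |` I) -> I x.
  move=> Xx ix; rewrite -(Imax (x |` I)) //; first by left.
    by split=> // y [->|/IX].
case: Xe => [Xe|[C [cC Ce CX]]].
  have [ie|] := pselect (indep M (e |` I)); last by right.
  by left; apply: add.
apply: contrapT => /not_orP [nIe /contrapT ie].
have [B bB IB] := basis_ext ie.
have iB : indep M B by case: bB.
have [B' [bB' CB' B's]] := basis_ext_in (circuit_setD1 cC Ce) bB.
have iB' : indep M B' by case: bB'.
have nB'e : ~ B' e.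
  move=> B'e; apply: (circuit_dep cC); apply: (indepS iB') => x Cx.
  by have [->//|xe] := pselect (x = e); apply: CB'.
have Be : B e by apply: IB; left.
have iBe : indep M (B `\ e) by apply: (indepS iB) => x [].
have nBe : ~ max_set (indep M) (B `\ e).
  move=> [_ /(_ B iB (@subDsetl _ _ _)) eB].
  by move: Be; rewrite eB => -[_]; apply.
have [z [B'z nBz] iz] := indep_exchange iBe nBe bB'.
have ze : z <> e by move=> ze; apply: nB'e; rewrite -ze.
have {}nBz : ~ B z by move=> Bz; apply: nBz; split.
have Xz : X z by case: (B's _ B'z) => // /CX.
apply/nBz/IB; right; apply: add => //.
apply: (indepS iz) => x [->|Ix]; first by left.
right; split; first by apply: IB; right.
by move=> xe; apply: nIe; rewrite -xe.
Qed.

(** Transitivity of span, without circuit elimination: a maximal independent subset of [X] stays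
    maximal in [X]|[Y]. *)
Lemma span_sub M X Y : Y `<=` span M X -> span M Y `<=` span M X.
Proof.
move=> YX e eY; have [I mI] := max_indep_ex M X.
have [[iI IX] _] := mI.
have mIY : max_set [set K | indep M K /\ K `<=` X `|` Y] I.
  split=> [|K [iK KXY] IK]; first by split=> // x /IX; left.
  apply/seteqP; split=> // x Kx.
  have : span M X x.
    case: (KXY _ Kx) => [Xx|/YX//].
    by split; [exact: indep_ground iK _ Kx | left].
  move=> /(max_indep_span mI) [//|[]].
  by apply: (indepS iK) => y [->|/IK].
have Ee : E e by case: eY.
have := max_indep_span mIY (spanS (@subsetUr _ X Y) eY).
case=> [Ie|de]; first by split=> //; left; exact: IX.
exact: spanS IX _ (span_indep iI Ee de).
Qed.

(** Orthogonality. If [C] and [D] met only in [d], then a basis avoiding [D]\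
    d[could be traded for one containing]C [\ d]; it would miss [d] and so all of [D], making [D]
    independent in the dual. *)
Lemma circuit_cocircuit M C D d : circuit M C -> circuit (dual M) D ->
  C d -> D d -> exists x, [/\ x <> d, C x & D x].
Proof.
move=> cC cD Cd Dd; apply: contrapT => nex.
have [B bB DB] : dual_indep M (D `\ d) := circuit_setD1 cD Dd.
have [B' [bB' CB' B's]] := basis_ext_in (circuit_setD1 cC Cd) bB.
have nB'd : ~ B' d.
  move=> B'd; apply: (circuit_dep cC); apply: (indepS bB'.1) => x Cx.
  by have [->//|xd] := pselect (x = d); apply: CB'.
apply: (circuit_dep cD); exists B' => // x Dx.
split; first exact: circuit_ground cD _ Dx.
have [->//|xd] := pselect (x = d).
move=> /B's [[Cx _]|Bx]; first by apply: nex; exists x.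
by have [] := DB _ (conj Dx xd).
Qed.

Lemma not_span_cocircuit M X e : E e -> ~ span M X e ->
  exists D, [/\ circuit (dual M) D, D e & D `&` X = set0].
Proof.
move=> Ee nXe; have [I mI] := max_indep_ex M X.
have [[iI IX] Imax] := mI.
have ie : indep M (e |` I).
  by apply: contrapT => /(span_indep iI Ee) /(spanS IX).
have [B bB IB] := basis_ext ie.
have Be : B e by apply: IB; left.
have bcB : basis (dual M) (E `\` B) by apply/basis_dual; exists B.
have dcB : ~ indep (dual M) (e |` (E `\` B)).
  move=> /bcB.2 eB.
  have [_] : (E `\` B) e by rewrite -eB; [left | move=> x; right].
  exact.
have [D [cD De DB]] := fundamental_circuit bcB.1 Ee dcB.
exists D; split=> //; apply/seteqP; split=> // x [Dx Xx].
have xe : x <> e.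
  by move=> xe; apply: nXe; split=> //; left; rewrite -xe.
have Ex := circuit_ground cD Dx.
have nBx : ~ B x by case: (DB _ Dx) => // -[].
have nIx : ~ I x by move=> Ix; apply/nBx/IB; right.
have dx : ~ indep M (x |` I).
  move=> ix; apply: nIx; rewrite -(Imax (x |` I)); first by left.
    by split=> // y [->|/IX].
  by move=> y; right.
have [C [cC Cx CI]] := fundamental_circuit iI Ex dx.
have [y [yx Cy Dy]] := circuit_cocircuit cC cD Cx Dx.
have Iy : I y by case: (CI _ Cy).
have By : B y by apply: IB; right.
case: (DB _ Dy) => [ye|[_ /(_ By)//]].
by apply: nXe; split=> //; left; apply: IX; rewrite -ye.
Qed.

End Span.

(** * Circuits, bases and duals of direct sums *)

Section DirectSum.
Context {T : Type} {E E1 E2 : set T}.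
Variables (M : matroid E) (M1 : matroid E1) (M2 : matroid E2).
Hypothesis sumM : is_direct_sum M M1 M2.

Lemma direct_sum_disjoint x : E1 x -> E2 x -> False.
Proof.
by case: sumM => _ E12 _ E1x E2x; have : (E1 `&` E2) x by []; rewrite E12.
Qed.

Lemma direct_sum_indepP I :
  indep M I <-> [/\ I `<=` E, indep M1 (I `&` E1) & indep M2 (I `&` E2)].
Proof.
have [EU _ sumE] := sumM.
split=> [iI|[IE i1 i2]].
  have /sumE[I1 [I2 [i1 i2 eI]]] := iI.
  split; first exact: indep_ground iI.
    apply: (indepS i1) => x [+ E1x]; rewrite eI => -[//|/(indep_ground i2)].
    by move=> /(direct_sum_disjoint E1x).
  apply: (indepS i2) => x [+ E2x]; rewrite eI => -[/(indep_ground i1)|//].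
  by move=> /direct_sum_disjoint/(_ E2x).
apply/sumE; exists (I `&` E1), (I `&` E2); split=> //.
apply/seteqP; split=> [x Ix|x [[]|[]]//].
by have := IE _ Ix; rewrite EU => -[]; [left|right].
Qed.

(** The trace of [C] on some summand is dependent, so by minimality it is all of [C]. *)
Lemma direct_sum_circuit C : circuit M C -> circuit M1 C \/ circuit M2 C.
Proof.
move=> cC; have [[CE dC] Cmin] := cC; have [EU _ _] := sumM.
have sE1 : E1 `<=` E by rewrite EU => x; left.
have sE2 : E2 `<=` E by rewrite EU => x; right.
have [i1|d1] := pselect (indep M1 (C `&` E1)); last first.
  left; have C1 : C `&` E1 = C.
    apply: Cmin => [|x []//]; split=> [x [] /CE//|/direct_sum_indepP [_]].
    by rewrite -setIA setIid.
  have CE1 : C `<=` E1 by rewrite -C1 => x [].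
  split; first by split=> //; rewrite -C1.
  move=> X [XE1 dX] XC; apply: Cmin => //; split=> [x /XE1/sE1//|].
  by move=> /direct_sum_indepP [_ + _]; rewrite setIidl.
have [i2|d2] := pselect (indep M2 (C `&` E2)).
  by case: dC; apply/direct_sum_indepP.
right; have C2 : C `&` E2 = C.
  apply: Cmin => [|x []//]; split=> [x [] /CE//|/direct_sum_indepP [_ _]].
  by rewrite -setIA setIid.
have CE2 : C `<=` E2 by rewrite -C2 => x [].
split; first by split=> //; rewrite -C2.
move=> X [XE2 dX] XC; apply: Cmin => //; split=> [x /XE2/sE2//|].
by move=> /direct_sum_indepP [_ _]; rewrite setIidl.
Qed.

Lemma direct_sum_basisU B1 B2 : basis M1 B1 -> basis M2 B2 ->
  basis M (B1 `|` B2).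
Proof.
have [EU _ sumE] := sumM.
move=> [i1 m1] [i2 m2]; split; first by apply/sumE; exists B1, B2.
move=> K /sumE[K1 [K2 [k1 k2 ->]]] sK.
have e1 : K1 = B1.
  apply: m1 => // x Bx; have [//|/(indep_ground k2) E2x] := sK x (or_introl Bx).
  by case: (direct_sum_disjoint (indep_ground i1 Bx) E2x).
have e2 : K2 = B2.
  apply: m2 => // x Bx; have [/(indep_ground k1) E1x|//] := sK x (or_intror Bx).
  by case: (direct_sum_disjoint E1x (indep_ground i2 Bx)).
by rewrite e1 e2.
Qed.

Lemma direct_sum_basis B : basis M B ->
  exists B1 B2, [/\ basis M1 B1, basis M2 B2 & B = B1 `|` B2].
Proof.
have [EU _ sumE] := sumM.
move=> [iB mB]; have /sumE[I1 [I2 [i1 i2 eB]]] := iB.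
have [B1 bB1 s1] := basis_ext i1; have [B2 bB2 s2] := basis_ext i2.
exists B1, B2; split=> //; apply/esym/mB.
  by case: (direct_sum_basisU bB1 bB2).
by rewrite eB => x [/s1|/s2]; [left|right].
Qed.

(** Bases of [M] are unions of bases of the summands, so their complements split too. With
    [direct_sum_circuit] this places every cocircuit in one summand. *)
Lemma direct_sum_dual : is_direct_sum (dual M) (dual M1) (dual M2).
Proof.
have [EU E12 sumE] := sumM.
split=> // I; split.
  move=> [B /direct_sum_basis [B1 [B2 [b1 b2 ->]]] IB].
  exists (I `&` E1), (I `&` E2); split.
  - exists B1 => // x [/IB [_ nB] E1x]; split=> // B1x.
    by apply: nB; left.
  - exists B2 => // x [/IB [_ nB] E2x]; split=> // B2x.
    by apply: nB; right.
  - apply/seteqP; split=> [x Ix|x [[]|[]]//].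
    by have [+ _] := IB _ Ix; rewrite EU => -[]; [left|right].
move=> [I1 [I2 [[B1 b1 I1B] [B2 b2 I2B] ->]]].
exists (B1 `|` B2); first exact: direct_sum_basisU.
rewrite EU => x [/I1B|/I2B] [Ex nBx].
  split; first by left.
  by move=> [//|/(basis_ground b2)/(direct_sum_disjoint Ex)].
split; first by right.
by move=> [/(basis_ground b1)/direct_sum_disjoint/(_ Ex)|].
Qed.

End DirectSum.

(** * Well-orders and finite maxima *)

Lemma well_order_exists (T : Type) : exists le : T -> T -> Prop,
  [/\ forall x y, le x y \/ le y x,
      forall x y, le x y -> le y x -> x = y,
      forall x y z, le x y -> le y z -> le x z &
      forall A : set T, A !=set0 -> exists2 m, A m & forall x, A x -> le m x].
Proof.
have [R woR] := wochoice.well_ordering_principle {classic T}.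
have minR (A : set T) : A !=set0 -> exists2 m, A m & forall x, A x -> R m x.
  move=> [x Ax]; have [|m [[/asboolP Am mA] _]] := woR (fun y => `[< A y >]).
    by exists x; apply/asboolP.
  by exists m => // y Ay; apply: mA; apply/asboolP.
(* Antisymmetry is the uniqueness of the minimum of a pair; totality and transitivity come from
   minima of sets of at most three elements. *)
have anti (x y : T) : R x y -> R y x -> x = y.
  move=> xy yx; have [|m [_ um]] := woR (fun z => `[< z = x \/ z = y >]).
    by exists x; apply/asboolP; left.
  have refl (z : T) : R z z.
    by have [|w -> ->] := minR [set z]; first by exists z.
  rewrite -(um x) ?(um y) //; split.
  - by apply/asboolP; right.
  - by move=> z /asboolP [->|->].
  - by apply/asboolP; left.
  - by move=> z /asboolP [->|->].
exists (fun x y => R x y); split=> // [x y|x y z xy yz].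
  have [|m [->|->] mA] := minR [set z | z = x \/ z = y].
  - by exists x; left.
  - by left; apply: mA; right.
  - by right; apply: mA; left.
have [|m mE mA] := minR [set w | [\/ w = x, w = y | w = z]].
  by exists x; apply: Or31.
have mx : R m x by apply/mA/Or31.
have my : R m y by apply/mA/Or32.
have mz : R m z by apply/mA/Or33.
case: mE => em; subst m => //.
  by rewrite (anti _ _ xy mx).
by rewrite -(anti _ _ yz my).
Qed.

Lemma finite_max (T : Type) (le : T -> T -> Prop) (A : set T) :
  (forall x y, le x y \/ le y x) -> (forall x y z, le x y -> le y z -> le x z) ->
  finite_set A -> A !=set0 -> exists2 m, A m & forall x, A x -> le x m.
Proof.
move=> tot trans fA.
have [s ->] := (@finite_seqP {classic T} A).1 fA.
elim: s => [[x]//|a s IH _].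
have refl x : le x x by case: (tot x x).
have [[b bs]|s0] := pselect ([set` s] !=set0); last first.
  exists a; first by rewrite /= mem_head.
  move=> x /=; rewrite inE => /orP [/eqP -> //|xs].
  by case: s0; exists x.
have [|m ms mmax] := IH; first by exists b.
have [am|ma] := tot a m.
  exists m; first by rewrite /= inE; apply/orP; right.
  move=> x /=; rewrite inE => /orP [/eqP -> //|]; exact: mmax.
exists a; first by rewrite /= mem_head.
move=> x /=; rewrite inE => /orP [/eqP -> //|xs].
by apply: trans ma; apply: mmax.
Qed.

(** * Greedy choice functions *)

(* [C X] consists of [X `&` P] and a base of the rest of [X] over it. *)
Lemma choice_function (T : Type) (E P : set T) (M : matroid E) :
  finitary_cofinitary_sum M ->
  exists C : set T -> set T,
    [/\ forall X, C X `<=` X,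
        forall X, X `&` P `<=` C X,
        forall X Y, X `<=` Y -> X `\` C X `<=` Y `\` C Y,
        forall X, X `<=` E -> X `<=` span M (C X) &
        forall X e, X `<=` E -> C X e -> ~ P e -> ~ span M (C X `\ e) e].
Proof.
move=> [E1 [E2 [M1 [M2 [sumM fin1 cofin2]]]]].
have [EU _ _] := sumM.
have disj := direct_sum_disjoint sumM.
have [le [tot anti trans minle]] := well_order_exists T.
have finmax := finite_max tot trans.
(* The elements examined before [e]: the smaller ones on [E1], the larger ones on [E2]. *)
pose r e := [set f | f <> e /\
  ([/\ E1 e, E1 f & le f e] \/ [/\ E2 e, E2 f & le e f])].
(* Rejection is tested against all earlier elements of [X], not only the kept ones; this makes it
   visibly monotone in [X]. *)
pose C X := [set e | X e /\ (P e \/ ~ span M (X `&` (P `|` r e)) e)].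
have rejected X e : X e -> ~ C X e -> span M (X `&` (P `|` r e)) e.
  by move=> Xe nCe; apply: contrapT => nse; apply: nCe; split=> //; right.
exists C; split.
- by move=> X e [].
- by move=> X e [Xe Pe]; split=> //; left.
- move=> X Y XY e [Xe nCe]; split; first exact: XY.
  move=> [_ Ce]; apply: nCe; split=> //; case: Ce => [|nY]; first by left.
  by right => sX; apply: nY; apply: spanS sX => x [/XY].
- move=> X XE e Xe; apply: contrapT => nse.
  have sC : C X `<=` span M (C X) by apply: sub_span => x [/XE].
  have := XE _ Xe; rewrite EU => -[E1e|E2e].
    (* On the finitary side, everything that caused the rejection of a least unspanned [m] is
       already spanned by [C X]. *)
    have [|m [E1m Xm nsm] mmin] :=
      minle [set x | [/\ E1 x, X x & ~ span M (C X) x]]; first by exists e.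
    have sm := rejected _ _ Xm (fun Cm => nsm (sC _ Cm)).
    apply: nsm; apply: span_sub sm => f [Xf [Pf|[fm]]].
      by apply: sC; split=> //; left.
    case=> [[_ E1f fle]|[E2m _ _]]; last by case: (disj _ E1m E2m).
    by apply: contrapT => nsf; apply/fm/anti => //; exact: mmin.
  (* On the cofinitary side, a cocircuit [D] through [e] avoiding [C X] is finite. Its greatest
     element [d] in [X] was rejected because of a circuit [Z], which by orthogonality meets [D] in
     another [x]; this [x] lies in [X] above [d]. *)
  have [D [cD De DC]] := not_span_cocircuit (XE _ Xe) nse.
  have {}DC x : D x -> ~ C X x.
    by move=> Dx Cx; have : (D `&` C X) x by []; rewrite DC.
  have [cD1|cD2] := direct_sum_circuit (direct_sum_dual sumM) cD.
    by case: (disj e (circuit_ground cD1 De) E2e).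
  have [|d [Dd Xd] dmax] := finmax (D `&` X) (finite_setIl _ (cofin2 _ cD2)).
    by exists e.
  have nPd : ~ P d by move=> Pd; apply: (DC _ Dd); split=> //; left.
  have [_ [[_ [//|[//]]]|[Z [cZ Zd ZX]]]] := rejected _ _ Xd (DC _ Dd).
  have [x [xd Zx Dx]] := circuit_cocircuit cZ cD Zd Dd.
  have [Xx [Px|[_]]] := ZX x (conj Zx xd).
    by apply: (DC _ Dx); split=> //; left.
  case=> [[E1d _ _]|[_ _ dx]].
    by apply: (disj _ E1d); exact: circuit_ground cD2 _ Dd.
  by apply: xd; apply: anti => //; exact: dmax.
- move=> X e XE Ce nPe [Ee [[_]|[Z [cZ Ze ZC]]]]; first exact.
  have {}ZC : Z `<=` C X.
    by move=> x Zx; have [->//|xe] := pselect (x = e); case: (ZC x).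
  have Y0 : Z `\` P !=set0 by exists e.
  (* The last examined element of [Z]\[P] is spanned by the rest of [Z], so it would have been
     rejected. It exists by finiteness of [Z] on [E1] and by well-ordering on [E2], where last means
     least. *)
  suff [z [Zz nPz] rz] :
      exists2 z, (Z `\` P) z & forall y, (Z `\` P) y -> y <> z -> r z y.
    have [_ [//|]] := ZC _ Zz; apply; split; first exact: circuit_ground cZ _ Zz.
    right; exists Z; split=> // y [Zy yz]; split; first by have [] := ZC _ Zy.
    by have [|nPy] := pselect (P y); [left | right; apply: rz].
  have [cZ1|cZ2] := direct_sum_circuit sumM cZ.
    have [z [Zz nPz] zmax] := finmax _ (finite_setIl _ (fin1 _ cZ1)) Y0.
    exists z => // y [Zy nPy] yz; split=> //; left; split; last exact: zmax.
      exact: circuit_ground cZ1 _ Zz.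
    exact: circuit_ground cZ1 _ Zy.
  have [z [Zz nPz] zmin] := minle _ Y0.
  exists z => // y [Zy nPy] yz; split=> //; right; split; last exact: zmin.
    exact: circuit_ground cZ2 _ Zz.
  exact: circuit_ground cZ2 _ Zy.
Qed.

(** * Fixpoint and conclusion *)

Lemma monotone_fixpoint (T : Type) (f : set T -> set T) :
  (forall X Y, X `<=` Y -> f X `<=` f Y) -> exists X, f X = X.
Proof.
move=> fS; pose U := [set x | exists2 X, X `<=` f X & X x].
have UfU : U `<=` f U.
  by move=> x [X Xf Xx]; apply: (fS X); [move=> y Xy; exists X | exact: Xf].
exists U; apply/seteqP; split=> // x fUx.
by exists (f U) => //; apply: fS.
Qed.

Theorem theorem1p6 (T : Type) (E : set T) (M : bool -> matroid E)
    (F_ : bool -> set T)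
    (hM : forall i, finitary_cofinitary_sum (M i))
    (hF : forall i, F_ i `<=` E) :
  exists F : set T, F `<=` E /\
    forall i, F_ i `<=` span (M i) F /\
      E `\` F_ (~~ i) `<=` span (dual (M i)) (E `\` F).
Proof.
have [C CP] := choice (fun i => choice_function (F_ (~~ i)) (hM i)).
pose R i X := X `\` C i X.
have RS i X Y : X `<=` Y -> R i X `<=` R i Y by case: (CP i) => _ _ + _ _; apply.
(* The map is monotone because the two complements cancel each other's reversal of inclusion. *)
have [X0 fixX0] : exists X, E `\` R true (E `\` R false X) = X.
  apply: monotone_fixpoint => X Y XY x [Ex nRx]; split=> // Rx; apply: nRx.
  by apply: (RS _ _ _ _ _ Rx) => y [Ey nRy]; split=> // Ry; apply/nRy/(RS _ X).
pose X i := if i then E `\` R false X0 else X0.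
(* One case is the definition of [X], the other is [fixX0]; from here on both indices are treated
   alike. *)
have XN i : X (~~ i) = E `\` R i (X i) by case: i.
have XE i : X i `<=` E by rewrite -[i]negbK XN => x [].
have FC i : X true `&` X false = C i (X i).
  have -> : X true `&` X false = X i `&` X (~~ i) by case: i; rewrite // setIC.
  have [CX _ _ _ _] := CP i; rewrite XN.
  apply/seteqP; split=> [x [Xx [_ nRx]]|x Cx].
    by apply: contrapT => nCx; apply: nRx.
  by have Xx := CX _ _ Cx; split=> //; split; [exact: XE Xx | case].
exists (X true `&` X false); split=> [x [/XE]//|i]; split=> e.
  move=> Fe; rewrite (FC i); have [_ _ _ sC _] := CP i; apply: sC => //.
  rewrite -[i]negbK XN; split; first exact: hF Fe.
  have [_ CF _ _ _] := CP (~~ i).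
  by move=> [Xe]; apply; apply: CF; split=> //; rewrite negbK.
move=> [Ee nFe].
have [Xe|nXe] := pselect ((X true `&` X false) e); last first.
  by apply: sub_span => // x [].
move: Xe; rewrite (FC i) => Ce; have [_ _ _ _ nsC] := CP i.
(* A cocircuit meeting [F] only in [e] has the rest of its elements in [E]\[F], so it spans [e] in
   the dual. *)
have [D [cD De DC]] := not_span_cocircuit Ee (nsC _ _ (XE i) Ce nFe).
split=> //; right; exists D; split=> // x [Dx xe].
split=> [|Cx]; first exact: circuit_ground cD _ Dx.
by have : (D `&` (C i (X i) `\ e)) x by []; rewrite DC.
Qed.
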